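(* Let $X$ be a graph with adjacency matrix $A$ and let $a,b\in V(X)$. The vertices $a$ and $b$ are strongly cospectral if and only if there is an orthogonal symmetry $Q$ of $X$ such that $Q$ is a polynomial in $A$, all entries of $Q$ are rational, $Q^2=I$ and $Qe_a=e_b$.
   Context: Graphs are finite, simple and undirected. Let $e_a$ ($a\in V(X)$) be the standard basis vectors of $\mathbb{R}^{V(X)}$. An orthogonal symmetry of $X$ is a real orthogonal matrix (rows and columns indexed by $V(X)$) that commutes with $A$. ''Polynomial in $A$'' means $Q=p(A)$ for some real polynomial $p$. Let $\theta_1,\ldots,\theta_m$ be the distinct eigenvalues of $A$ and let $E_r$ be the matrix representing orthogonal projection onto the $\theta_r$-eigenspace. Vertices $a,b$ are strongly cospectral if for each $r$ we have $E_re_a=E_re_b$ or $E_re_a=-E_re_b$. *)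

(* Defs.v *)
From mathcomp Require Import all_boot all_order all_algebra.
From mathcomp Require Import reals.

Set Implicit Arguments.
Unset Strict Implicit.
Unset Printing Implicit Defensive.

Import Order.TTheory GRing.Theory Num.Theory.
Local Open Scope ring_scope.

(* A matrix with rows and columns indexed by V is a square matrix of size
   #|V|, the vertex a corresponding to the index enum_rank a. *)

Definition adjmx (R : realType) (V : finType) (adj : rel V) : 'M[R]_#|V| :=
  \matrix_(i, j) (adj (enum_val i) (enum_val j))%:R.

Definition basis_vec (R : realType) (V : finType) (a : V) : 'cV[R]_#|V| :=
  delta_mx (enum_rank a) 0.

(* mxpoly's horner_mx only accepts matrices of size n.+1, which #|V| is not
   syntactically; A ^+ i is the power in the ring 'M_n, so A ^+ 0 = 1%:M. *)
Definition polymx (R : realType) (n : nat) (p : {poly R}) (A : 'M[R]_n) :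
    'M[R]_n :=
  \sum_(i < size p) p`_i *: A ^+ i.

(* The matrix P with P *m v the orthogonal projection of the column v onto the
   subspace W.  A subspace is given, as in mxalgebra, by the row space of a
   matrix W, whose orthogonal complement is kermx W^T; proj_mx projects row
   vectors by multiplication on the right, hence the final transpose. *)
Definition orth_proj (R : realType) (n : nat) (W : 'M[R]_n) : 'M[R]_n :=
  (proj_mx W (kermx W^T))^T.

(* eigenspace B consists of the rows u with u *m B = theta *: u; for B := A^T
   these are the transposes of the columns v with A *m v = theta *: v. *)
Definition eigenproj (R : realType) (n : nat) (A : 'M[R]_n) (theta : R) :
    'M[R]_n :=
  orth_proj (eigenspace A^T theta).

Definition strongly_cospectral (R : realType) (V : finType) (adj : rel V)
    (a b : V) : Prop :=
  let A := adjmx R adj in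
  forall theta : R, eigenvalue A theta ->
    eigenproj A theta *m basis_vec R a = eigenproj A theta *m basis_vec R b \/
    eigenproj A theta *m basis_vec R a = - (eigenproj A theta *m basis_vec R b).

Definition orthogonal_symmetry (R : realType) (V : finType) (adj : rel V)
    (Q : 'M[R]_#|V|) : Prop :=
  Q *m Q^T = 1%:M /\ Q *m adjmx R adj = adjmx R adj *m Q.

(* Main.v *)
Require Import Defs.
From mathcomp Require Import all_boot all_order all_algebra.
From mathcomp Require Import reals complex.

(** Put u = e_a + e_b and w = e_a - e_b, and write p(A) for the value of a
polynomial p at A.

An involution p(A) that sends e_a to e_b gives strong cospectrality: p(A) acts
on the eigenspace of theta as the scalar p(theta), whose square is 1, so that
E_theta e_b = p(theta) E_theta e_a.

Conversely, strong cospectrality says that every eigenspace is orthogonal to u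
or to w.  As A is real symmetric, it is annihilated by a product of real linear
factors X - r, and the factors whose eigenspace is orthogonal to a vector can be
left out of a polynomial that annihilates this vector
([drop_orthogonal_roots]).  So u and w have annihilators that are products of
linear factors with no common root; the Bezout identity then gives a real
polynomial f with f(A) u = u and f(A) w = 0 ([separating_polynomial]).

These two equations are linear in the coefficients of f, and A, u and w are
rational; hence they also have a rational solution f
([horner_mx_solution_descent]). It need not make f(A) idempotent, but an
idempotent can be found over the rationals: a symmetric B = f(A) over an
ordered field satisfies B = B^2 h(B) for some polynomial h
([symmetric_von_neumann_regular]), so that E = B h(B) is an idempotent that
still fixes u and kills w ([polynomial_idempotent]). Then Q = 2 E - 1 is a
rational polynomial in A with Q^2 = 1, Q u = u and Q w = - w, that is Q e_a =
e_b; it is orthogonal because it is symmetric. *)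

Set Implicit Arguments.
Unset Strict Implicit.
Unset Printing Implicit Defensive.

Import Order.TTheory GRing.Theory Num.Theory.
Local Open Scope ring_scope.

(** * Polynomials in a symmetric matrix *)

Lemma trmx_mul_eq0 (F : realDomainType) m n (M : 'M[F]_(m, n)) :
  M^T *m M = 0 -> M = 0.
Proof.
move=> MM0; apply/matrixP=> i j; rewrite mxE; apply/eqP.
have /eqP := congr1 (fun N : 'M_n => N j j) MM0; rewrite !mxE.
rewrite psumr_eq0 => [/allP/(_ i)|k _]; last by rewrite mxE -expr2 sqr_ge0.
by rewrite mem_index_enum mxE -expr2 sqrf_eq0 => /(_ isT).
Qed.

Lemma tr_horner_mx (F : comNzRingType) n (A : 'M[F]_n.+1) p :
  A^T = A -> (horner_mx A p)^T = horner_mx A p.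
Proof.
move=> symA; elim/poly_ind: p => [|p c IHp]; first by rewrite rmorph0 trmx0.
rewrite rmorphD rmorphM /= horner_mx_X horner_mx_C linearD /= tr_scalar_mx.
by rewrite trmx_mul IHp symA; congr (_ + _); apply/comm_mx_horner.
Qed.

Lemma horner_mx_comp (F : comNzRingType) n (A : 'M[F]_n.+1) p q :
  horner_mx A (p \Po q) = horner_mx (horner_mx A q) p.
Proof.
elim/poly_ind: p => [|p c IHp]; first by rewrite comp_poly0 !rmorph0.
rewrite comp_polyD comp_polyM comp_polyX comp_polyC !(rmorphD, rmorphM) /= IHp.
by rewrite horner_mx_X !horner_mx_C.
Qed.

Lemma polymx_horner_mx (R : realType) n (A : 'M[R]_n.+1) p :
  polymx p A = horner_mx A p.
Proof.
rewrite -[p in RHS]coefK poly_def rmorph_sum; apply: eq_bigr => i _.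
by rewrite /= linearZ /= rmorphXn /= horner_mx_X.
Qed.

Lemma eigen_horner_mx (F : fieldType) n (A : 'M[F]_n.+1) p t m
    (W : 'M[F]_(m, n.+1)) :
  W *m A = t *: W -> W *m horner_mx A p = p.[t] *: W.
Proof.
move=> WA; elim/poly_ind: p => [|p c IHp].
  by rewrite rmorph0 mulmx0 horner0 scale0r.
rewrite rmorphD rmorphM /= horner_mx_X horner_mx_C mulmxDr mulmxA IHp.
by rewrite -scalemxAl WA mul_mx_scalar scalerA -scalerDl !hornerE.
Qed.

(** B^(k+1) Y has Gram matrix Y^T B^k B^(k+2) Y, so the exponent k+2 can be
lowered to k+1. *)
Lemma symmetric_exp_mul_eq0 (F : realDomainType) n (B : 'M[F]_n.+1) k m
    (Y : 'M[F]_(n.+1, m)) :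
  B^T = B -> B ^+ k *m Y = 0 -> B *m Y = 0.
Proof.
move=> symB; elim: k => [|k IHk].
  by rewrite expr0 mul1mx => ->; rewrite mulmx0.
case: k IHk => [_|k IHk]; first by rewrite expr1.
move=> BY; apply: IHk; apply: trmx_mul_eq0.
have symBk : (B ^+ k.+1)^T = B ^+ k.+1.
  have := tr_horner_mx ('X^(k.+1)) symB.
  by rewrite rmorphXn /= horner_mx_X.
rewrite trmx_mul symBk mulmxA -(mulmxA _ _ (B ^+ k.+1)).
have -> : B ^+ k.+1 *m B ^+ k.+1 = B ^+ k *m B ^+ k.+2.
  by rewrite !mulmxE -!exprD addSnnS.
by rewrite -2!(mulmxA _ _ Y) BY !mulmx0.
Qed.

(** * Idempotents among the polynomials in a symmetric matrix *)

(** By Cayley-Hamilton, B^k c(B) = 0 where X^k is the exact power of X dividing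
the characteristic polynomial, so c(0) <> 0.  Symmetry lowers k to 1, and
B c(B) = 0 expresses B as a multiple of B^2. *)
Lemma symmetric_von_neumann_regular (F : realFieldType) n (B : 'M[F]_n.+1) :
  B^T = B -> exists h, B = B * B * horner_mx B h.
Proof.
move=> symB; have [k [c]] := multiplicity_XsubC (char_poly B) 0.
rewrite subr0 monic_neq0 ?char_poly_monic //= => c0 chiB.
have Bc : B *m horner_mx B c = 0.
  apply: (@symmetric_exp_mul_eq0 _ _ _ k) => //.
  have := Cayley_Hamilton B; rewrite chiB mulrC rmorphM rmorphXn /=.
  by rewrite horner_mx_X.
have [q cq] : exists q, c = c.[0]%:P + 'X * q.
  have /factor_theorem[q cq] : root (c - c.[0]%:P) 0.
    by rewrite rootE !hornerE subrr.
  by exists q; rewrite mulrC -['X]subr0 -cq addrC subrK.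
exists (- c.[0]^-1 *: q).
move: Bc; rewrite {1}cq mulmxE rmorphD rmorphM /= horner_mx_X horner_mx_C.
rewrite -scalemx1 mulrDr mulrA -scalerAr mulr1 => /eqP.
rewrite addr_eq0 => /eqP Bq.
by rewrite linearZ /= -scalerAr scaleNr -scalerN -Bq scalerA mulVf // scale1r.
Qed.

(** With B = f(A) = B^2 h(B), the idempotent is B h(B): it is the projection
onto the range of B along its kernel. *)
Lemma polynomial_idempotent (F : realFieldType) n (A : 'M[F]_n.+1) f m k
    (U : 'M[F]_(n.+1, m)) (W : 'M[F]_(n.+1, k)) :
    A^T = A -> horner_mx A f *m U = U -> horner_mx A f *m W = 0 ->
  exists g, [/\ horner_mx A g * horner_mx A g = horner_mx A g,
    horner_mx A g *m U = U & horner_mx A g *m W = 0].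
Proof.
move=> symA; set B := horner_mx A f => BU BW.
have [h Bh] := symmetric_von_neumann_regular (tr_horner_mx f symA).
rewrite -/B in Bh; exists (f * (h \Po f)).
rewrite rmorphM /= horner_mx_comp -/B.
set H := horner_mx B h in Bh *.
have comBH : B * H = H * B by apply: comm_mx_horner.
have BHB : B * H * B = B by rewrite -mulrA -comBH mulrA -Bh.
split.
- by rewrite mulrA BHB.
- by rewrite -{1}BU mulmxA mulmxE BHB.
- by rewrite comBH -mulmxE -mulmxA BW mulmx0.
Qed.

(** * Descent of linear equations to a subfield *)

(** The condition p(A) U = V on the coefficients of p is a linear system, and a
linear system over F that is solvable over an extension is solvable over F. *)
Lemma horner_mx_solution_descent (F L : fieldType) (iota : {rmorphism F -> L})
    n m (A : 'M[F]_n.+1) (U V : 'M[F]_(n.+1, m)) p :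
    horner_mx (map_mx iota A) p *m map_mx iota U = map_mx iota V ->
  exists q, horner_mx A q *m U = V.
Proof.
move=> pUV; pose d := size p.
(* Row i of K is A^i U; a solution is a combination of these rows equal to V. *)
pose K (E : fieldType) (B : 'M[E]_n.+1) (T : 'M_(n.+1, m)) :=
  \matrix_(i < d) mxvec (B ^+ i *m T).
have KE (E : fieldType) (B : 'M[E]_n.+1) T (v : 'rV_d) :
    v *m K E B T = mxvec (horner_mx B (rVpoly v) *m T).
  have -> : K E B T = powers_mx B d *m lin_mx (mulmxr T).
    by apply/row_matrixP=> i; rewrite row_mul !rowK mul_vec_lin.
  by rewrite mulmxA -[v *m _]vec_mxK mul_vec_lin /= horner_rVpoly.
have /submxP[v Vv] : (mxvec V <= K F A U)%MS.
  rewrite -(map_submx iota) map_mxvec -pUV; apply/submxP.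
  exists (poly_rV p).
  have -> : map_mx iota (K F A U) = K L (map_mx iota A) (map_mx iota U).
    apply/row_matrixP=> i; rewrite -map_row !rowK map_mxvec map_mxM.
    by rewrite rmorphXn.
  by rewrite KE poly_rV_K.
exists (rVpoly v); apply: (can_inj mxvecK).
by rewrite -KE.
Qed.

(** * Separating two vectors by a real polynomial *)

(** The complex matrix A is hermitian, so that it is diagonalizable with real
eigenvalues; the product runs over these with multiplicity. *)
Lemma symmetric_split_annihilator (R : realType) n (A : 'M[R]_n.+1) :
  A^T = A -> exists rs : seq R, horner_mx A (\prod_(r <- rs) ('X - r%:P)) = 0.
Proof.
move=> symA; pose toC : {rmorphism R -> R[i]} := real_complex R.
pose AC := map_mx toC A.
have hermA : AC \is hermsymmx.
  apply: realsym_hermsym.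
    by apply/is_hermitianmxP; rewrite expr0 scale1r map_mx_id // map_trmx symA.
  by apply/mxOverP=> i j; rewrite mxE; apply/complex_realP; exists (A i j).
have /orthomx_spectralP AE := hermitian_normalmx hermA.
have /mxOverP dR := hermitian_spectral_diag_real hermA.
set P := spectralmx AC in AE; set D := spectral_diag AC in AE dR.
have uP : P \in unitmx by exact: spectral_unit.
exists [seq complex.Re (D 0 i) | i <- enum 'I_n.+1].
apply: (map_mx_inj (f := toC)); rewrite map_horner_mx raddf0.
rewrite -/AC AE -{2}[P]invmxK horner_mx_uconj ?unitmx_inv // horner_mx_diag.
rewrite map_prod_XsubC -(big_map toC xpredT (fun z => 'X - z%:P)) -map_comp.
set q := \prod_(_ <- _) _.
suff -> : map_mx (horner q) D = 0 by rewrite raddf0 mulmx0 mul0mx.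
apply/matrixP=> i j; rewrite ord1 !mxE; apply/rootP.
rewrite root_prod_XsubC; apply/mapP; exists j; first by rewrite mem_enum.
by rewrite /= RRe_real.
Qed.

Lemma coprimep_prod_XsubC (F : fieldType) (rs : seq F) (P Q : pred F) :
    (forall r, ~~ (P r && Q r)) ->
  coprimep (\prod_(r <- rs | P r) ('X - r%:P))
           (\prod_(r <- rs | Q r) ('X - r%:P)).
Proof.
move=> PQ; apply: (big_ind (coprimep _)) => [|p q cp cq|r Qr].
- exact: coprimep1.
- by rewrite coprimepMr cp.
- rewrite coprimep_XsubC -big_filter root_prod_XsubC mem_filter.
  by have := PQ r; rewrite Qr andbT => /negPf->.
Qed.

(** If (A - r) y = 0 where y = p(A) x and x is orthogonal to the eigenspace of
r, then y^T y = y^T p(A) x = 0, because y^T p(A) is in that eigenspace.  So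
the factor X - r is superfluous.  The cofactor k collects the factors that are
kept in the induction on the list. *)
Lemma drop_orthogonal_roots (F : realFieldType) n (A : 'M[F]_n.+1) m
    (x : 'M[F]_(n.+1, m)) (rs : seq F) k :
    A^T = A -> horner_mx A (k * \prod_(r <- rs) ('X - r%:P)) *m x = 0 ->
  horner_mx A (k * \prod_(r <- rs | eigenspace A r *m x != 0) ('X - r%:P))
    *m x = 0.
Proof.
move=> symA; elim: rs k => [|r rs IHrs] k; first by rewrite !big_nil.
rewrite !big_cons mulrCA.
case: ifPn => [_|/negPn/eqP Wx]; first by rewrite mulrCA !mulrA => /IHrs.
set p := k * \prod_(r <- rs) ('X - r%:P) => pL; apply: IHrs; rewrite -/p.
apply: trmx_mul_eq0.
move: pL; rewrite rmorphM /= rmorphB /= horner_mx_X horner_mx_C -mulmxE.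
set y := horner_mx A p *m x => pL.
have Ay : y^T *m A = r *: y^T.
  rewrite -{1}symA -trmx_mul -linearZ /=; congr trmx; apply/eqP.
  by rewrite -subr_eq0 -mul_scalar_mx -mulmxBl /y mulmxA pL.
have /eigenspaceP/submxP[D yW] := Ay.
rewrite {2}/y mulmxA (eigen_horner_mx _ Ay) -scalemxAl yW.
by rewrite -mulmxA Wx mulmx0 scaler0.
Qed.

(** From a Bezout identity a g_U + b g_W = 1, where g_U kills U and g_W kills W,
the polynomial b g_W fixes U and kills W. *)
Lemma separating_polynomial (R : realType) n (A : 'M[R]_n.+1) m k
    (U : 'M[R]_(n.+1, m)) (W : 'M[R]_(n.+1, k)) :
    A^T = A ->
    (forall r, eigenspace A r *m U = 0 \/ eigenspace A r *m W = 0) ->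
  exists f, horner_mx A f *m U = U /\ horner_mx A f *m W = 0.
Proof.
move=> symA UW; have [rs Ars] := symmetric_split_annihilator symA.
have kill l (X : 'M[R]_(n.+1, l)) :
    horner_mx A (\prod_(r <- rs | eigenspace A r *m X != 0) ('X - r%:P)) *m X
    = 0.
  rewrite -[\prod_(_ <- _ | _) _]mul1r; apply: drop_orthogonal_roots => //.
  by rewrite mul1r Ars mul0mx.
have coUW : coprimep
    (\prod_(r <- rs | eigenspace A r *m U != 0) ('X - r%:P))
    (\prod_(r <- rs | eigenspace A r *m W != 0) ('X - r%:P)).
  apply: coprimep_prod_XsubC => r.
  by case: (UW r) => ->; rewrite eqxx //= andbF.
have /Bezout_eq1_coprimepP[[a b] /= ab1] := coUW.
exists (b * \prod_(r <- rs | eigenspace A r *m W != 0) ('X - r%:P)).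
split; last by rewrite rmorphM -mulmxE -mulmxA kill mulmx0.
have /(congr1 (fun p => horner_mx A p *m U)) := ab1.
rewrite rmorphD rmorph1 mulmxDl mul1mx => {2}<-.
by rewrite [in RHS]rmorphM -[in RHS]mulmxE -[in RHS]mulmxA kill mulmx0 add0r.
Qed.

(** * Orthogonal projections onto the eigenspaces *)

(** An eigenspace and its orthogonal complement meet trivially because the dot
product is positive definite, and then they span by a rank count; so the
projection kills exactly the complement. *)
Lemma eigenproj_mul_eq0 (R : realType) n (A : 'M[R]_n) t m (X : 'M[R]_(n, m)) :
  eigenproj A t *m X = 0 <-> eigenspace A^T t *m X = 0.
Proof.
rewrite /eigenproj /orth_proj; set W := eigenspace _ _.
set K := kermx W^T.
have capWK : (W :&: K)%MS = 0.
  apply/eqP; rewrite -submx0; apply/rV_subP=> v; rewrite sub_capmx.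
  case/andP=> /submxP[D vD] /sub_kermxP vK; rewrite submx0; apply/eqP.
  apply: trmx_inj; rewrite trmx0; apply: trmx_mul_eq0.
  by rewrite trmxK {2}vD trmx_mul mulmxA vK mul0mx.
have sWK : (X^T <= W + K)%MS.
  apply: submx_full; rewrite /row_full mxrank_disjoint_sum //.
  by rewrite (mxrank_ker W^T) mxrank_tr subnKC ?rank_leq_row.
have XK : (X^T <= K)%MS = (W *m X == 0).
  by rewrite sub_kermx -trmx_mul trmx_eq0.
split=> [PX|/eqP]; last first.
  rewrite -XK => /(proj_mx_0 capWK) XP.
  by apply: trmx_inj; rewrite trmx_mul trmxK XP trmx0.
have {}PX : X^T *m proj_mx W K = 0.
  by apply: trmx_inj; rewrite trmx_mul trmxK PX trmx0.
apply/eqP; rewrite -XK -(add_proj_mx capWK sWK) PX add0r.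
exact: proj_mx_sub.
Qed.

(** * Strong cospectrality and involutions *)

Lemma idempotent_reflection (S : pzRingType) (e : S) :
  e * e = e -> (e + e - 1) * (e + e - 1) = 1.
Proof.
move=> ee; rewrite mulrBr mulr1 mulrBl mul1r mulrDl !mulrDr ee.
by rewrite addrK opprB addrC subrK.
Qed.

Definition projections_agree_up_to_sign (R : realType) n (A : 'M[R]_n)
    (x y : 'cV[R]_n) : Prop :=
  forall t, eigenvalue A t ->
    eigenproj A t *m x = eigenproj A t *m y \/
    eigenproj A t *m x = - (eigenproj A t *m y).

(** On the eigenspace of t the involution is the scalar p(t), so p(t) = 1 or
p(t) = -1, and y - p(t) x is orthogonal to this eigenspace. *)
Lemma agree_up_to_sign_of_polynomial_involution (R : realType) n
    (A : 'M[R]_n.+1) p (x y : 'cV[R]_n.+1) :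
    A^T = A -> horner_mx A p *m horner_mx A p = 1%:M ->
    horner_mx A p *m x = y ->
  projections_agree_up_to_sign A x y.
Proof.
move=> symA QQ Qx t W0; set W := eigenspace A t.
have WQ : W *m horner_mx A p = p.[t] *: W.
  exact/eigen_horner_mx/eigenspaceP.
have pt : p.[t] ^+ 2 == 1.
  rewrite -subr_eq0; have /eqP : (p.[t] ^+ 2 - 1) *: W = 0.
    rewrite scalerBl scale1r expr2 -scalerA -WQ scalemxAl -WQ -mulmxA QQ mulmx1.
    by rewrite subrr.
  by rewrite scalemx_eq0 -/W (negPf W0) orbF.
have : eigenproj A t *m (y - p.[t] *: x) = 0.
  apply/eigenproj_mul_eq0; rewrite symA -/W mulmxBr -Qx mulmxA WQ.
  by rewrite -scalemxAl scalemxAr subrr.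
rewrite mulmxBr => /eqP; rewrite subr_eq0 => /eqP ->.
move: pt; rewrite sqrf_eq1 => /orP[] /eqP ->.
  by left; rewrite scale1r.
by right; rewrite scaleN1r mulmxN opprK.
Qed.

(** The involution is 2 E - 1, where the idempotent E fixes x + y and kills
x - y: then E x = E y and 2 E x = E (x + y) = x + y, whence 2 E x - x = y. *)
Lemma rational_polynomial_involution_exists (R : realType) n
    (A0 : 'M[rat]_n.+1) (x0 y0 : 'cV[rat]_n.+1)
    (A := map_mx ratr A0 : 'M[R]_n.+1)
    (x := map_mx ratr x0 : 'cV[R]_n.+1) (y := map_mx ratr y0 : 'cV[R]_n.+1) :
    A0^T = A0 -> projections_agree_up_to_sign A x y ->
  exists p, horner_mx A0 p *m horner_mx A0 p = 1%:M /\
            horner_mx A0 p *m x0 = y0.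
Proof.
move=> symA0 sc; have symA : A^T = A by rewrite map_trmx symA0.
have sep r : eigenspace A r *m (x + y) = 0 \/ eigenspace A r *m (x - y) = 0.
  have [/sc[]|] := boolP (eigenvalue A r).
  - move/eqP; rewrite -subr_eq0 -mulmxBr => /eqP/eigenproj_mul_eq0.
    by rewrite symA; right.
  - move/eqP; rewrite -addr_eq0 -mulmxDr => /eqP/eigenproj_mul_eq0.
    by rewrite symA; left.
  - by rewrite negbK => /eqP->; rewrite !mul0mx; left.
have [f [fu fw]] := separating_polynomial symA sep.
have [f0] : exists f0,
    horner_mx A0 f0 *m row_mx (x0 + y0) (x0 - y0) = row_mx (x0 + y0) 0.
  apply: (@horner_mx_solution_descent _ _ (ratr : {rmorphism rat -> R})
            _ _ _ _ _ f).
  rewrite !map_row_mx map_mx0 map_mxB map_mxD -/A -/x -/y.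
  by rewrite mul_mx_row fu fw.
rewrite mul_mx_row => /eq_row_mx[f0u f0w].
have [g [gg gu gw]] := polynomial_idempotent symA0 f0u f0w.
exists (g + g - 1); rewrite rmorphB rmorphD rmorph1 /=.
set E := horner_mx A0 g in gg gu gw *.
split; first exact: idempotent_reflection.
move: gu gw; rewrite mulmxDr mulmxBr => Exy /eqP; rewrite subr_eq0 => /eqP Ex.
rewrite mulmxBl mulmxDl mul1mx {2}Ex.
by rewrite Exy addrC addKr.
Qed.

(** The index type #|V| of the adjacency matrix is not syntactically a
successor, as the evaluation of polynomials at a matrix requires; so the
equivalence is stated for every positive n. *)
Lemma rational_agree_up_to_signP (R : realType) n (A0 : 'M[rat]_n)
    (x0 y0 : 'cV[rat]_n) (A := map_mx ratr A0 : 'M[R]_n)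
    (x := map_mx ratr x0 : 'cV[R]_n) (y := map_mx ratr y0 : 'cV[R]_n) :
    (0 < n)%N -> A0^T = A0 ->
  projections_agree_up_to_sign A x y <->
  exists Q : 'M[R]_n,
    [/\ Q *m Q^T = 1%:M /\ Q *m A = A *m Q,
        exists p : {poly R}, Q = polymx p A,
        forall i j, exists q : rat, Q i j = ratr q,
        Q *m Q = 1%:M
      & Q *m x = y].
Proof.
case: n => // n in A0 x0 y0 A x y * => _ symA0; split=> [sc|]; last first.
  case=> Q [_ [p ->] _ QQ Qx]; rewrite polymx_horner_mx in QQ Qx.
  apply: agree_up_to_sign_of_polynomial_involution QQ Qx.
  by rewrite map_trmx symA0.
have [p [QQ Qx]] := rational_polynomial_involution_exists symA0 sc.
exists (map_mx ratr (horner_mx A0 p)).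
have QQR : map_mx ratr (horner_mx A0 p) *m map_mx ratr (horner_mx A0 p) = 1%:M
    :> 'M[R]_n.+1.
  by rewrite -map_mxM QQ map_mx1.
split=> //.
- rewrite map_trmx tr_horner_mx //; split=> //.
  by rewrite -!map_mxM; congr map_mx; apply/esym/comm_mx_horner.
- by exists (map_poly ratr p); rewrite polymx_horner_mx map_horner_mx.
- by move=> i j; exists (horner_mx A0 p i j); rewrite mxE.
- by rewrite -map_mxM Qx.
Qed.

Theorem theorem11p2 (R : realType) (V : finType) (adj : rel V)
    (adj_sym : symmetric adj) (adj_irr : irreflexive adj) (a b : V) :
  strongly_cospectral R adj a b <->
  exists Q : 'M[R]_#|V|,
    [/\ orthogonal_symmetry adj Q,
        exists p : {poly R}, Q = polymx p (adjmx R adj),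
        forall i j, exists q : rat, Q i j = ratr q,
        Q *m Q = 1%:M
      & Q *m basis_vec R a = basis_vec R b].
Proof.
pose A0 : 'M[rat]_#|V| := \matrix_(i, j) (adj (enum_val i) (enum_val j))%:R.
have symA0 : A0^T = A0 by apply/matrixP=> i j; rewrite !mxE adj_sym.
have V_gt0 : (0 < #|V|)%N by apply/card_gt0P; exists a.
rewrite /strongly_cospectral /orthogonal_symmetry /basis_vec.
have -> : adjmx R adj = map_mx ratr A0.
  by apply/matrixP=> i j; rewrite !mxE ratr_nat.
rewrite -!(map_delta_mx (ratr : {rmorphism rat -> R})).
exact: rational_agree_up_to_signP.
Qed.
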